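(* Let $\sigma$ be a partition of the set of all primes and let $G\neq 1$ be a finite group. Then the following statements are equivalent: (1) $G$ is $\sigma$-nilpotent; (2) each vertex of the graph $\Gamma_{H\sigma}(G)$ is isolated; (3) each vertex of the graph $\Gamma_{\mathfrak{N}_\sigma}(G)$ is isolated; (4) $G$ is $\sigma$-soluble and each vertex of the graph $\Gamma_{\sigma Hal}(G)$ is isolated.
   Context: All groups are finite. $\mathbb{P}$ is the set of all primes, $\pi(n)$ is the set of primes dividing the integer $n$, and $\pi(G)=\pi(|G|)$. $\sigma=\{\sigma_i\mid i\in I\}$ is a partition of $\mathbb{P}$: $\mathbb{P}=\bigcup_{i\in I}\sigma_i$ and $\sigma_i\cap\sigma_j=\emptyset$ for $i\ne j$. Put $\sigma(n)=\{\sigma_i\mid \sigma_i\cap\pi(n)\neq\emptyset\}$ and $\sigma(G)=\sigma(|G|)$. For a set of primes $\pi$, a $\pi$-group is a group $X$ with $\pi(X)\subseteq\pi$; a Hall $\pi$-subgroup is a $\pi$-subgroup whose index is divisible by no prime in $\pi$. A chief factor $H/K$ of $G$ is $\sigma$-central in $G$ if for some $i$ both $H/K$ and $G/C_G(H/K)$ are $\sigma_i$-groups. $G$ is: $\sigma$-soluble if every chief factor of $G$ is a $\sigma_i$-group for some $i$ (depending on the factor); $\sigma$-nilpotent if every chief factor of $G$ is $\sigma$-central in $G$; $\{\sigma_i\}$-nilpotent if every chief factor $H/K$ of $G$ with $\pi(H/K)\cap\sigma_i\neq\emptyset$ is $\sigma$-central in $G$. $F_{\{\sigma_i\}}(G)$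 is the largest normal $\{\sigma_i\}$-nilpotent subgroup of $G$. $\mathfrak{N}_\sigma$ is the class of all $\sigma$-nilpotent groups; an $\mathfrak{N}_\sigma$-critical group is a non-$\sigma$-nilpotent group all of whose proper subgroups are $\sigma$-nilpotent. The following are directed graphs with vertex set $\sigma(G)$. $\Gamma_{H\sigma}(G)$ ($\sigma$-Hawkes graph): $(\sigma_i,\sigma_j)$ is an edge iff $\sigma_j\in\sigma(G/F_{\{\sigma_i\}}(G))$. $\Gamma_{\sigma Hal}(G)$ ($\sigma$-Hall graph): $(\sigma_i,\sigma_j)$ is an edge iff for some Hall $\sigma_i$-subgroup $H$ of $G$ we have $\sigma_j\in\sigma(N_G(H)/HC_G(H))$. $\Gamma_{\mathfrak{N}_\sigma}(G)$ ($\sigma$-Vasil'ev-Murashko graph): $(\sigma_i,\sigma_j)$ is an edge iff for some $\mathfrak{N}_\sigma$-critical subgroup $H$ of $G$ we have $\sigma_i\in\sigma(H)$ and $\sigma_j\in\sigma(H/F_{\{\sigma_i\}}(H))$. A vertex is isolated if no edge (including loops) starts or ends at it; thus every vertex is isolated iff the edge set is empty. *)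

(* Defs.v *)
From mathcomp Require Import all_boot all_fingroup all_solvable.
From mathcomp Require Import boolp.

Set Implicit Arguments.
Unset Strict Implicit.
Unset Printing Implicit Defensive.

Local Open Scope group_scope.

(* Blocks may be empty; an empty block is never a vertex of the graphs below. *)
Definition prime_partition (I : Type) (sigma : I -> nat_pred) : Prop :=
  [/\ forall i p, p \in sigma i -> prime p,
      forall p, prime p -> exists i, p \in sigma i
    & forall i j, i <> j -> forall p, ~~ ((p \in sigma i) && (p \in sigma j))].

(* The members of sigma(n), given by their indices: nonempty blocks with
   different indices are different. *)
Definition sigma_of (I : Type) (sigma : I -> nat_pred) (n : nat) (i : I) : Prop :=
  exists2 p, p \in \pi(n) & p \in sigma i.

Section SigmaProperties.

Variables (I : Type) (sigma : I -> nat_pred) (gT : finGroupType).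
Implicit Types G H K : {group gT}.

(* [chief_factor G K H] says that H / K is a chief factor of G; below,
   ['C_G(H / K | 'Q)] is the centraliser C_G(H / K). *)
Definition sigma_central G K H : Prop :=
  exists i, (sigma i).-group (H / K)
         /\ (sigma i).-group (G / 'C_G(H / K | 'Q)).

Definition sigma_soluble G : Prop :=
  forall K H, chief_factor G K H -> exists i, (sigma i).-group (H / K).

Definition sigma_nilpotent G : Prop :=
  forall K H, chief_factor G K H -> sigma_central G K H.

Definition block_nilpotent (i : I) G : Prop :=
  forall K H, chief_factor G K H ->
    sigma_of sigma #|H / K| i -> sigma_central G K H.

Definition sigma_nilpotent_critical G : Prop :=
  ~ sigma_nilpotent G /\ forall H, H \proper G -> sigma_nilpotent H.

(* [block_Fitting_largest] below shows that this join is the largest normal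
   {sigma_i}-nilpotent subgroup. *)
Definition block_Fitting (i : I) G : {set gT} :=
  <<\bigcup_(N : {group gT} | (N <| G) && `[< block_nilpotent i N >]) N>>.

Canonical block_Fitting_group i G := Eval hnf in [group of block_Fitting i G].

End SigmaProperties.

Section BlockFitting.

Variables (I : Type) (sigma : I -> nat_pred) (gT : finGroupType).
Hypothesis sigmaP : prime_partition sigma.
Implicit Types G H K N X Y : {group gT}.

Lemma prime_partition_inj i j p : p \in sigma i -> p \in sigma j -> i = j.
Proof.
move=> ip jp; case: sigmaP => _ _ dis.
by have [// | /dis/(_ p)] := pselect (i = j); rewrite ip jp.
Qed.

Lemma pnat_index_sub (pi : nat_pred) N X Y :
  X <| N -> Y \subset N -> pi.-nat #|N : X| -> pi.-nat #|Y : X|.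
Proof.
move=> nsXN sYN; have nXN := normal_norm nsXN.
rewrite -(card_quotient nXN) -(card_quotient (subset_trans sYN nXN)).
exact: pgroupS (quotientS _ sYN).
Qed.

(* {sigma_i}-nilpotency is the existence of a normal Hall complement to
   sigma_i. *)
Lemma block_nilpotent_compl i N : block_nilpotent sigma i N ->
  exists X : {group gT},
    [/\ X <| N, (sigma i)^'.-group X & (sigma i).-nat #|N : X|].
Proof.
set pi := sigma i => nilN.
pose P (U : {group gT}) := (U <| N) && [exists X : {group gT},
  [&& X <| N, U \subset X, pi^'.-nat #|X : U| & pi.-nat #|N : X|]].
have [U minU] : {U : {group gT} | [min U | P U]}.
  apply: ex_mingroup; exists N; rewrite /P normal_refl.
  by apply/existsP; exists N; rewrite normal_refl subxx indexgg.
have /mingroupP[/andP[nsUN /existsP[X /and4P[nsXN sUX pi'XU piNX]]] Umin] := minU.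
have [U1 | ntU] := eqVneq U 1%G.
  by exists X; split=> //; move: pi'XU; rewrite U1 indexg1.
have [V maxV]: {V : {group gT} | maxnormal V U N}.
  by apply: ex_maxgroup; exists 1%G; rewrite proper1G ntU norms1.
have chUV : chief_factor N V U by rewrite /chief_factor maxV.
have /andP[ltVU nVN] := maxgroupp maxV; have sVU := proper_sub ltVU.
have nsVN : V <| N.
  by rewrite /normal (subset_trans sVU (normal_sub nsUN)).
have nVU : U \subset 'N(V) := subset_trans (normal_sub nsUN) nVN.
suff PV : P V.
  by have := Umin V PV sVU; move=> defV; rewrite /= defV properxx in ltVU.
rewrite /P nsVN; apply/existsP.
have oUV : #|U / V| = #|U : V| by rewrite card_quotient.
have [pi'UV | ] := boolP (pi^'.-group (U / V)).
  exists X; rewrite nsXN (subset_trans sVU sUX) piNX andbT /=.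
  by rewrite -(Lagrange_index sUX sVU) pnatM pi'XU -oUV.
rewrite /pgroup /pnat cardG_gt0 /= => /allPn[p UVp]; rewrite inE /= negbK => pip.
have [|j [jUV]] := nilN _ _ chUV; first by exists p.
have ij : i = j by exact: prime_partition_inj pip (pnatPpi jUV UVp).
subst j; set C := 'C_N(U / V | 'Q)%G => piNC.
have sCN : C \subset N by exact: subsetIl.
have nsCN : C <| N.
  rewrite /normal sCN normsI ?normG //.
  apply: subset_trans (astab_norm 'Q _).
  exact: actsQ nVN (normal_norm nsUN).
have sVC : V \subset C.
  by rewrite subsetI (normal_sub nsVN) sub_astabQ normG trivg_quotient sub1G.
pose Y := (X :&: C)%G.
have nsYN : Y <| N by exact: normalI.
have sVY : V \subset Y by rewrite subsetI sVC (subset_trans sVU sUX).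
have sYN := normal_sub nsYN; have nVY := subset_trans sYN nVN.
have sYX : Y \subset X := subsetIl _ _.
have piNY : pi.-nat #|N : Y|.
  rewrite -(Lagrange_index sCN (subsetIr X C)) pnatM; apply/andP; split.
    by rewrite -card_quotient ?normal_norm.
  have := pnat_index_sub nsXN sCN piNX; rewrite -indexgI.
  by rewrite [C :&: X]setIC.
pose Z := ((Y :&: U) / V)%G.
have piZ : pi.-group Z by apply: pgroupS jUV; rewrite quotientS ?subsetIr.
have sZY : Z \subset Y / V by rewrite quotientS ?subsetIl.
have cZ : Y / V \subset 'C(Z).
  have: Y \subset 'C(U / V | 'Q).
    exact: subset_trans (subsetIr X C) (subsetIr _ _).
  rewrite sub_astabQ => /andP[_ cYU]; apply: subset_trans cYU (centS _).
  by rewrite quotientS ?subsetIr.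
have nsZY : Z <| Y / V by rewrite /normal sZY cents_norm.
have hallZ : pi.-Hall(Y / V) Z.
  rewrite /pHall sZY piZ /=; rewrite index_quotient_eq ?subsetIl //; last first.
    by rewrite subsetI subsetIl subIset // sVU orbT.
  rewrite indexgI; apply: pnat_index_sub sYX pi'XU.
  exact: normalS sUX (normal_sub nsXN) nsUN.
have /splitsP[K complK] := SchurZassenhaus_split (pHall_Hall hallZ) nsZY.
have hallK : pi^'.-Hall(Y / V) K by rewrite -(compl_pHall _ hallZ).
have nsKY : K <| Y / V.
  have [_ defY] := complP complK; rewrite /normal (pHall_sub hallK).
  rewrite -defY mul_subG ?normG //; apply: cents_norm.
  by rewrite centsC (subset_trans _ cZ) ?(pHall_sub hallK).
pose O := 'O_pi^'(Y / V)%G; have defO : O = K.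
  by apply/val_inj; exact: normal_Hall_pcore hallK nsKY.
have nsON : O <| N / V.
  by apply: char_normal_trans (pcore_char _ _) (quotient_normal _ nsYN).
have sVO : V \subset coset V @*^-1 O by exact: sub_cosetpre.
exists (coset V @*^-1 O)%G.
have sON : coset V @*^-1 O <| N.
  by rewrite -(quotientGK nsVN) cosetpre_normal.
have sOY : coset V @*^-1 O \subset Y.
  by rewrite -(quotientGK (normalS sVY sYN nsVN)) morphpreS ?pcore_sub.
apply/and4P; split=> //.
  rewrite -card_quotient ?(subset_trans (normal_sub sON)) //.
  by rewrite cosetpreK; exact: pcore_pgroup.
have piYO : pi.-nat #|Y / V : O|.
  by rewrite defO; case/and3P: hallK => _ _; rewrite pnatNK.
have := Lagrange_index sYN sOY => <-; rewrite -[_ && _]/(pi.-nat _) pnatM piNY.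
by rewrite -index_cosetpre quotientGK ?(normalS sVY sYN nsVN) in piYO.
Qed.

Lemma compl_block_nilpotent i N X :
    X <| N -> (sigma i)^'.-group X -> (sigma i).-nat #|N : X| ->
  block_nilpotent sigma i N.
Proof.
set pi := sigma i => nsXN pi'X piNX K H chHK [p HKp pip].
have /andP[/maxgroupP[/andP[ltKH nKN] maxK] nsHN] := chHK.
have sKH := proper_sub ltKH; have sHN := normal_sub nsHN.
have sXN := normal_sub nsXN.
have nKH := subset_trans sHN nKN.
have sHXH : H :&: X \subset H by exact: subsetIl.
pose L := (K <*> (H :&: X))%G.
have sKL : K \subset L by exact: joing_subl.
have sLH : L \subset H by rewrite join_subG sKH.
have nLN : N \subset 'N(L).
  by rewrite normsY // normsI ?normal_norm.
have sHXK : H :&: X \subset K.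
  have [ltLH | ] := boolP (L \proper H).
    by rewrite -(maxK L) ?ltLH ?joing_subr.
  rewrite properEneq sLH andbT negbK => /eqP/val_inj defL.
  have pi'HK : pi^'.-group (H / K).
    rewrite -defL /= quotientYidl ?(subset_trans sHXH) //.
    by rewrite quotient_pgroup // (pgroupS (subsetIr _ _)).
  by have := pnatPpi pi'HK HKp; rewrite inE /= pip.
exists i; split.
  rewrite /pgroup card_quotient //; apply: pnat_dvd (indexgS _ sHXK) _.
  by rewrite indexgI (pnat_index_sub nsXN).
have nC : N \subset 'N('C_N(H / K | 'Q)).
  rewrite normsI ?normG //; apply: subset_trans (astab_norm 'Q _).
  exact: actsQ nKN (normal_norm nsHN).
rewrite /pgroup card_quotient //; apply: pnat_dvd (indexgS _ _) piNX.
rewrite subsetI sXN sub_astabQR ?(subset_trans sXN) //.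
apply: subset_trans sHXK; rewrite subsetI commg_subr commg_subl.
by rewrite (subset_trans sXN (normal_norm nsHN)) (subset_trans sHN (normal_norm nsXN)).
Qed.

Lemma block_nilpotentY i G N1 N2 :
    N1 <| G -> N2 <| G ->
  block_nilpotent sigma i N1 -> block_nilpotent sigma i N2 ->
  block_nilpotent sigma i (N1 <*> N2).
Proof.
move=> nsN1 nsN2 /block_nilpotent_compl[X1 [nsX1 pi'X1 piX1]].
move=> /block_nilpotent_compl[X2 [nsX2 pi'X2 piX2]].
have nsXG N X : N <| G -> X <| N -> (sigma i)^'.-group X ->
    (sigma i).-nat #|N : X| -> X <| G.
  move=> nsN nsX pi'X piX.
  have hallX : (sigma i)^'.-Hall(N) X.
    by rewrite /pHall normal_sub // pi'X pnatNK.
  by rewrite -(normal_Hall_pcore hallX nsX) (char_normal_trans (pcore_char _ _)).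
have nsX1G := nsXG _ _ nsN1 nsX1 pi'X1 piX1.
have nsX2G := nsXG _ _ nsN2 nsX2 pi'X2 piX2.
have nsXG' : X1 <*> X2 <| G by exact: normalY.
have sNG : N1 <*> N2 \subset G by rewrite join_subG !normal_sub.
have nX12 : X2 \subset 'N(X1).
  exact: subset_trans (normal_sub nsX2G) (normal_norm nsX1G).
have nN12 : N2 \subset 'N(N1).
  exact: subset_trans (normal_sub nsN2) (normal_norm nsN1).
have nXN1 := subset_trans (normal_sub nsN1) (normal_norm nsXG').
have nXN2 := subset_trans (normal_sub nsN2) (normal_norm nsXG').
apply: (@compl_block_nilpotent i _ (X1 <*> X2)%G).
- by rewrite (normalS _ sNG nsXG') // genS // setUSS ?normal_sub.
- by rewrite /= norm_joinEr // pgroupM pi'X1.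
rewrite -card_quotient ?(subset_trans sNG) ?normal_norm //= [N1 <*> N2]norm_joinEr //.
rewrite quotientMl // -/(pgroup _ _) pgroupM /pgroup !card_quotient //.
by rewrite (pnat_dvd (indexgS _ (joing_subl _ _)) piX1)
           (pnat_dvd (indexgS _ (joing_subr _ _)) piX2).
Qed.

Lemma block_Fitting_largest i G :
  [/\ block_Fitting sigma i G <| G,
      block_nilpotent sigma i (block_Fitting sigma i G)
    & forall N, N <| G -> block_nilpotent sigma i N ->
        N \subset block_Fitting sigma i G].
Proof.
pose P N := (N <| G) && `[< block_nilpotent sigma i N >].
have [M /maxgroupP[/andP[nsMG /asboolP nilM] maxM]] : {M | [max M | P M]}.
  apply: ex_maxgroup; exists 1%G; rewrite /P normal1; apply/asboolP.
  by apply: (@compl_block_nilpotent i _ 1%G); rewrite ?normal1 ?pgroup1 ?indexgg.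
have sM N : P N -> N \subset M.
  case/andP=> nsNG /asboolP nilN.
  rewrite -(maxM (M <*> N)%G) ?joing_subl ?joing_subr // /P normalY //=.
  by apply/asboolP; exact: block_nilpotentY nsMG nsNG nilM nilN.
have defF : block_Fitting_group sigma i G = M.
  apply/val_inj/eqP; rewrite eqEsubset /= gen_subG.
  apply/andP; split; first by apply/bigcupsP=> N; exact: sM.
  apply: sub_gen; apply: (bigcup_sup M); rewrite ?subxx // nsMG.
  exact/asboolP.
rewrite -[block_Fitting sigma i G]/(gval (block_Fitting_group sigma i G)) defF.
by split=> // N nsNG nilN; apply: sM; rewrite /P nsNG; exact/asboolP.
Qed.

End BlockFitting.

Record digraph (V : Type) := Digraph {
  vertex : V -> Prop;
  edge : V -> V -> Prop
}.

Definition isolated (V : Type) (D : digraph V) (v : V) : Prop :=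
  forall w, vertex D w -> ~ edge D v w /\ ~ edge D w v.

Definition all_isolated (V : Type) (D : digraph V) : Prop :=
  forall v, vertex D v -> isolated D v.

Section SigmaGraphs.

Variables (I : Type) (sigma : I -> nat_pred) (gT : finGroupType).
Implicit Types G H : {group gT}.

Definition Hawkes_graph G : digraph I :=
  Digraph (sigma_of sigma #|G|)
    (fun i j => sigma_of sigma #|G / block_Fitting sigma i G| j).

Definition Hall_graph G : digraph I :=
  Digraph (sigma_of sigma #|G|)
    (fun i j => exists2 H : {group gT}, (sigma i).-Hall(G) H
       & sigma_of sigma #|'N_G(H) / (H * 'C_G(H))| j).

Definition Vasilev_Murashko_graph G : digraph I :=
  Digraph (sigma_of sigma #|G|)
    (fun i j => exists H : {group gT},
       [/\ H \subset G, sigma_nilpotent_critical sigma H,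
           sigma_of sigma #|H| i
         & sigma_of sigma #|H / block_Fitting sigma i H| j]).

End SigmaGraphs.

(* Main.v *)
(* A group is sigma-nilpotent iff it has a normal complement to every block
   sigma_i, so sigma-nilpotency passes to subgroups and the first three
   conditions are close to the definitions. The substance is that a sigma-soluble
   group G in which N_G(H) = H C_G(H) for all Hall sigma_i-subgroups H is
   sigma-nilpotent. Let N be a minimal normal subgroup, a sigma_i-group. The
   hypothesis passes to G / N, by a Frattini argument; so by induction G / N has a
   normal Hall sigma_i-subgroup P / N. Then P is normal in G, hence G = P C_G(P),
   which yields a normal complement to P. For j <> i, normal sigma_j-complements
   lift from G / N because N is a sigma_j'-group. *)
Require Import Defs.
From mathcomp Require Import all_boot all_fingroup all_solvable.
From mathcomp Require Import boolp.

Set Implicit Arguments.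
Unset Strict Implicit.
Unset Printing Implicit Defensive.

Local Open Scope group_scope.

(** * Chief factors, normal Hall subgroups and their complements *)

Section FiniteGroups.

Variable gT : finGroupType.
Implicit Types (pi : nat_pred) (G H K L N P X : {group gT}).

(* Let L1 be a minimal supplement of N in L. By the Frattini argument the Sylow
   subgroups of N :&: L1 are normal in L1, so N :&: L1 is nilpotent. Replacing L
   by L1, only the conjugacy of complements of a solvable normal Hall
   subgroup is then needed, and not the Feit-Thompson theorem. *)
Lemma Frattini_complement pi N K L :
    N <| L -> K <| L -> pi.-Hall(K) N ->
  exists2 H : {group gT}, pi^'.-Hall(K) H & N * 'N_L(H) = L.
Proof.
move=> nsNL nsKL hallN; have [sNL nNL] := andP nsNL.
have [sKL nKL] := andP nsKL; have [sNK piN pi'KN] := and3P hallN.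
have [L1 minL1] :
    {L1 : {group gT} | [min L1 | (L1 \subset L) && (N * L1 == L)]}.
  by apply: ex_mingroup; exists L; rewrite subxx /= mulSGid.
have /mingroupP[/andP[sL1L /eqP defL] minL] := minL1.
pose N1 := (N :&: L1)%G; pose K1 := (K :&: L1)%G.
have nsN1 : N1 <| L1.
  by rewrite /normal subsetIr normsI ?normG ?(subset_trans sL1L).
have nsK1 : K1 <| L1.
  by rewrite /normal subsetIr normsI ?normG ?(subset_trans sL1L).
have solN1 : solvable N1.
  suff sN1F : N1 \subset 'F(N1).
    exact: nilpotent_sol (nilpotentS sN1F (Fitting_nil N1)).
  rewrite -{1}(Sylow_gen N1) gen_subG; apply/bigcupsP=> P /SylowP[p _ sylP].
  have defL1 : N1 * 'N_L1(P) = L1 := Frattini_arg nsN1 sylP.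
  have defN : 'N_L1(P) = L1.
    apply: (minL 'N_L1(P)%G); last exact: subsetIl.
    rewrite /= (subset_trans (subsetIl _ _)) //=; apply/eqP.
    rewrite -[in RHS]defL -[in RHS]defL1 mulgA.
    by rewrite (mulGSid (_ : N1 \subset N)) ?subsetIl.
  apply: Fitting_max (pgroup_nil (pHall_pgroup sylP)).
  rewrite /normal (pHall_sub sylP) (subset_trans (normal_sub nsN1)) //.
  by rewrite -defN subsetIr.
have sN1K1 : N1 \subset K1 by rewrite setSI.
have nsN1K1 : N1 <| K1 by rewrite (normalS _ _ nsN1) ?subsetIr.
have defK : N * K1 = K.
  by rewrite [K1 : {set gT}]setIC group_modl // defL; apply/setIidPr.
have oK1 : #|K1 : N1| = #|K : N|.
  rewrite -(card_quotient (normal_norm nsN1K1)) -card_quotient; last first.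
    exact: subset_trans sKL nNL.
  rewrite -[in RHS]defK quotientMidl.
  have nNK1 : K1 \subset 'N(N) by rewrite subIset // (subset_trans sKL nNL).
  have -> : N1 = (N :&: K1)%G.
    apply/val_inj; rewrite /= setIA; congr (_ :&: _).
    by apply/esym/setIidPl.
  exact: card_isog (second_isog nNK1).
have piN1 : pi.-group N1 by apply: pgroupS piN; rewrite subsetIl.
have hallN1 : pi.-Hall(K1) N1 by rewrite /pHall sN1K1 piN1 oK1.
have /splitsP[H complH] := SchurZassenhaus_split (pHall_Hall hallN1) nsN1K1.
have hallH : pi^'.-Hall(K1) H by rewrite -(compl_pHall _ hallN1).
have [sHK1 pi'H _] := and3P hallH.
have oH : #|H| = #|K : N|.
  have [tiNH defK1] := complP complH.
  by rewrite -oK1 -divgS // -defK1 TI_cardMg // mulKn.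
exists H.
  rewrite /pHall (subset_trans sHK1) ?subsetIl // pi'H.
  have := Lagrange (subset_trans sHK1 (subsetIl _ _)).
  rewrite -(Lagrange sNK) -oH mulnC => /eqP; rewrite eqn_pmul2r // => /eqP ->.
  by rewrite pnatNK.
apply/eqP; rewrite eqEsubset mul_subG ?subsetIl //=.
rewrite -{1}defL; suff: L1 \subset N * 'N_L(H).
  by move/(mulgS N); rewrite mulgA mulGid.
have nNNH : 'N_L(H) \subset 'N(N) by rewrite subIset ?nNL.
rewrite -(normC nNNH); apply/subsetP=> x L1x.
have nN1H : H \subset 'N(N1).
  exact: subset_trans sHK1 (normal_norm nsN1K1).
(* Both [H] and [H :^ x] are complements of [N1] in the normal subgroup [K1] of [L1], hence
   conjugate by some [y] in [N1]; then [x * y^-1] normalises [H]. *)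
have [|||y /setIP[Ny L1y] defHx] :=
    SchurZassenhaus_trans_sol (K1 := (H :^ x)%G) solN1 nN1H.
- have [_ ->] := complP complH.
  by rewrite -(normsP (normal_norm nsK1) x L1x) conjSg.
- exact: pnat_coprime piN1 pi'H.
- by rewrite cardJg.
rewrite -(mulgKV y x) mem_mulg // inE groupM ?groupV ?(subsetP sL1L) //=.
by apply/normP; rewrite conjsgM [H :^ x]defHx conjsgK.
Qed.

(** An invariant subgroup above the preimage of [K] contains [N], so it is the preimage of its own
    image, and the maximality of [K] applies to that image. *)
Lemma chief_factor_cosetpre G N (K H : {group coset_of N}) :
    N <| G -> chief_factor (G / N) K H ->
  chief_factor G (coset N @*^-1 K) (coset N @*^-1 H).
Proof.
move=> nsNG /andP[/maxgroupP[/andP[ltKH nKG] maxK] nsHG].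
have pre_normal (M : {group coset_of N}) : M <| G / N -> coset N @*^-1 M <| G.
  by move=> nsMG; rewrite -(quotientGK nsNG) cosetpre_normal.
rewrite /chief_factor pre_normal // andbT.
have nsKG : K <| G / N.
  by rewrite /normal (subset_trans (proper_sub ltKH) (normal_sub nsHG)).
apply/maxgroupP; rewrite cosetpre_proper ltKH normal_norm ?pre_normal //.
split=> // M /andP[ltMH nMG] sKM.
have sNM : N \subset M := subset_trans (sub_cosetpre _) sKM.
have sMG : M \subset G.
  exact: subset_trans (proper_sub ltMH) (normal_sub (pre_normal _ nsHG)).
have defM := quotientGK (normalS sNM sMG nsNG).
rewrite -defM; congr (coset N @*^-1 _); apply: maxK.
  by rewrite -cosetpre_proper /= defM ltMH quotient_norms.
by rewrite -(cosetpreK K) quotientS.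
Qed.

Lemma minnormal_chief_factor G N :
  minnormal N G -> N \subset G -> chief_factor G 1 N.
Proof.
case/mingroupP=> /andP[ntN nNG] minN sNG.
rewrite /chief_factor /normal sNG nNG !andbT.
apply/maxgroupP; rewrite proper1G ntN norms1; split=> // M /andP[ltMN nMG] _.
apply/eqP; apply: contraTT (ltMN) => ntM.
have defM : M :=: N by apply: minN; rewrite ?ntM ?(proper_sub ltMN).
by rewrite defM properxx.
Qed.

(* As G = P * 'C_G(P), the group G / 'C_G(P) is a pi-group, so any complement
   of P centralises P. *)
Lemma normal_Hall_cent_compl pi G P :
    P <| G -> pi.-Hall(G) P -> G \subset P * 'C_G(P) ->
  exists X : {group gT}, [/\ X <| G, pi^'.-group X & pi.-nat #|G : X|].
Proof.
move=> nsPG hallP sGPC; have [sPG piP _] := and3P hallP.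
have /splitsP[X complX] := SchurZassenhaus_split (pHall_Hall hallP) nsPG.
have hallX : pi^'.-Hall(G) X by rewrite -(compl_pHall _ hallP).
have [sXG pi'X piGX] := and3P hallX.
have nsCG : 'C_G(P) <| G.
  by have := subcent_normal G P; rewrite (setIidPl (normal_norm nsPG)).
have nCG := normal_norm nsCG.
have piGC : pi.-group (G / 'C_G(P)).
  apply: pgroupS (quotient_pgroup 'C_G(P) piP).
  rewrite /= -[P / _]quotientMidr.
  exact: quotientS.
have sXC : X \subset 'C_G(P).
  rewrite -quotient_sub1 ?(subset_trans sXG) // subG1 trivg_card1.
  apply/eqP; apply: (@pnat_1 pi); last exact: quotient_pgroup.
  exact: pgroupS (quotientS _ sXG) piGC.
have cPX : P \subset 'C(X) by rewrite centsC (subset_trans sXC) ?subsetIr.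
exists X; split; rewrite -?(pnatNK pi) //.
by rewrite /normal sXG -(complP complX).2 mul_subG ?normG ?cents_norm.
Qed.

(** Write the Hall subgroup as [K / N] and find a Hall subgroup [H] of [G] with the same image and
    with ['N_G(K)] inside [N * 'N_G(H)]. The normaliser of [K / N] is then covered by the image of
    ['N_G(H)], to which the hypothesis applies. If [N] is a [pi]-group, [H] is [K] itself; otherwise
    [H] complements [N] in [K]. *)
Lemma Hall_norm_cent_quotient pi G N :
    N <| G -> pi.-group N || pi^'.-group N ->
    (forall H, pi.-Hall(G) H -> 'N_G(H) \subset H * 'C_G(H)) ->
  forall K : {group coset_of N}, pi.-Hall(G / N) K ->
    'N_(G / N)(K) \subset K * 'C_(G / N)(K).
Proof.
move=> nsNG piN hypG Kb hallKb; have nNG := normal_norm nsNG.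
have [K defKb sNK sKG] := inv_quotientS nsNG (pHall_sub hallKb).
rewrite defKb in hallKb *.
have nsNK : N <| K := normalS sNK sKG nsNG.
have [H [hallH defHK sLNH]] : exists H : {group gT},
    [/\ pi.-Hall(G) H, H / N = K / N & 'N_G(K) \subset N * 'N_G(H)].
  case/orP: piN => piN.
    exists K; split=> //; last exact: mulG_subr.
    by rewrite -(pquotient_pHall piN nsNG nsNK).
  have nsNL : N <| 'N_G(K).
    rewrite (normalS _ (subsetIl _ _) nsNG) // subsetI normal_sub //.
    by rewrite (subset_trans sNK) ?normG.
  have hallN : pi^'.-Hall(K) N.
    rewrite /pHall sNK piN pnatNK -(card_quotient (normal_norm nsNK)).
    exact: pHall_pgroup hallKb.
  (* The roles of [pi] and [pi^'] are exchanged here: [N] is a Hall [pi^']-subgroup of [K], and its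
     complement [H] is a Hall [pi]-subgroup. *)
  have [H hallHK defL] := Frattini_complement nsNL (normalSG sKG) hallN.
  have complH : H \in [complements to N in K] by rewrite (compl_pHall _ hallN).
  have [_ defK] := complP complH.
  have /and3P[sHK piH pi'H] : pi.-Hall(K) H by rewrite -pHallNK.
  exists H; split.
  - rewrite /pHall (subset_trans sHK sKG) piH /=.
    rewrite -(Lagrange_index sKG sHK) pnatM pi'H andbT.
    rewrite -(index_quotient_eq (H := N) _ sKG) ?subIset ?sNK ?orbT //.
    by case/and3P: hallKb.
  - by rewrite -[in RHS]defK quotientMidl.
  by rewrite -{1}defL mulgS // setSI ?subsetIl.
rewrite -quotient_subnormG //.
apply: subset_trans (quotientS N sLNH) _; rewrite quotientMidl.
apply: subset_trans (quotientS N (hypG H hallH)) _.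
rewrite quotientMl ?(subset_trans (pHall_sub hallH)) // defHK mulgS //.
by rewrite -defHK quotient_subcent.
Qed.

(** As a join, the denominator in the Hall graph is visibly a group, so lemmas on quotients by
    groups apply. *)
Lemma mulg_subcent G H : H * 'C_G(H) = H <*> 'C_G(H).
Proof. by rewrite norm_joinEr // subIset // cent_sub orbT. Qed.

Lemma norm_cent_quotient1 G H :
  #|'N_G(H) / (H * 'C_G(H))| = 1%N <-> 'N_G(H) \subset H * 'C_G(H).
Proof.
rewrite mulg_subcent; split=> [/card1_trivg/trivgP | sNHC]; last first.
  by rewrite quotientS1 ?cards1.
by rewrite quotient_sub1 // normsY ?subsetIr ?subcent_norm.
Qed.

(** Ensures that every block meeting this order is a vertex of the Hall graph. *)
Lemma norm_cent_quotient_dvd G H :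
  (#|'N_G(H) / (H * 'C_G(H))| %| #|G|)%N.
Proof.
by rewrite mulg_subcent (dvdn_trans (dvdn_quotient _ _)) ?cardSg ?subsetIl.
Qed.

End FiniteGroups.

(** * Sigma-nilpotency through normal complements to the blocks *)

Section SigmaNilpotency.

Variables (I : Type) (sigma : I -> nat_pred).
Hypothesis sigmaP : prime_partition sigma.

Lemma block_nilpotentP (gT : finGroupType) i (G : {group gT}) :
  block_nilpotent sigma i G <-> exists X : {group gT},
    [/\ X <| G, (sigma i)^'.-group X & (sigma i).-nat #|G : X|].
Proof.
split=> [|[X []]]; first exact: block_nilpotent_compl.
exact: compl_block_nilpotent.
Qed.

Lemma sigma_of_neq1 n : (0 < n)%N -> n != 1%N -> exists i, sigma_of sigma n i.
Proof.
move=> n_gt0 n_neq1; have n_gt1 : (1 < n)%N by rewrite ltn_neqAle eq_sym n_neq1.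
have [_ cover _] := sigmaP; have [i pi] := cover _ (pdiv_prime n_gt1).
by exists i, (pdiv n); rewrite ?pi_pdiv.
Qed.

Lemma sigma_of_dvd m n i :
  (0 < n)%N -> (m %| n)%N -> sigma_of sigma m i -> sigma_of sigma n i.
Proof. by move=> n_gt0 mn [p pm pi]; exists p => //; exact: pi_of_dvd pm. Qed.

Lemma sigma_block_neq i j p : p \in sigma j -> p \notin sigma i -> j <> i.
Proof. by move=> pj /negP pi' ij; apply: pi'; rewrite -ij. Qed.

Lemma sub_block_compl i j : j <> i -> {subset sigma j <= (sigma i)^'}.
Proof.
move=> ji p pj; rewrite inE /=; apply/negP=> pi; apply: ji.
exact: prime_partition_inj sigmaP _ _ _ pj pi.
Qed.

Section OneGroupType.

Variable gT : finGroupType.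
Implicit Types G H K N P X Y : {group gT}.

(** A chief factor is nontrivial, so its order meets some block, and nilpotency for that block makes
    the factor central. *)
Lemma sigma_nilpotent_blocks G :
  sigma_nilpotent sigma G <-> forall i, block_nilpotent sigma i G.
Proof.
split=> [nilG i K H chHK _ | nilG K H chHK]; first exact: nilG.
have [i HKi] : exists i, sigma_of sigma #|H / K| i.
  apply: sigma_of_neq1; rewrite // -trivg_card1.
  have /andP[/maxgroupp/andP[/andP[_ not_sHK] nKG] nsHG] := chHK.
  by rewrite -subG1 quotient_sub1 // (subset_trans (normal_sub nsHG)).
exact: nilG HKi.
Qed.

(** A normal complement in [G] meets [H] in a normal complement. *)
Lemma block_nilpotentS i G H :
  H \subset G -> block_nilpotent sigma i G -> block_nilpotent sigma i H.
Proof.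
move=> sHG /block_nilpotentP[X [nsXG pi'X piX]]; apply/block_nilpotentP.
exists (H :&: X)%G; split; first exact: normalGI sHG nsXG.
  by rewrite (pgroupS _ pi'X) ?subsetIr.
by rewrite indexgI (pnat_index_sub nsXG).
Qed.

Lemma sigma_nilpotentS G H :
  H \subset G -> sigma_nilpotent sigma G -> sigma_nilpotent sigma H.
Proof.
move=> sHG /sigma_nilpotent_blocks nilG; apply/sigma_nilpotent_blocks=> i.
exact: block_nilpotentS sHG (nilG i).
Qed.

(** The group is its own complement. This settles the blocks that are not vertices of the graphs. *)
Lemma block_nilpotent_sigma' i G :
  ~ sigma_of sigma #|G| i -> block_nilpotent sigma i G.
Proof.
move=> not_Gi; apply/block_nilpotentP; exists G.
rewrite normal_refl indexgg; split=> //.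
apply/pgroupP=> p p_pr pG; rewrite inE /=; apply/negP=> pi.
by apply: not_Gi; exists p; rewrite ?mem_primes ?p_pr ?cardG_gt0.
Qed.

(** Turns the absence of Hawkes edges leaving block [i] into nilpotency for that block. *)
Lemma block_Fitting_id i G :
  #|G / block_Fitting sigma i G| = 1%N <-> block_nilpotent sigma i G.
Proof.
have [nsFG nilF maxF] := block_Fitting_largest sigmaP i G.
split=> [/card1_trivg/trivgP | nilG]; last by rewrite quotientS1 ?maxF ?cards1.
rewrite quotient_sub1 ?normal_norm // => sGF.
exact: block_nilpotentS sGF nilF.
Qed.

(** Take [Y] minimal among the normal subgroups whose index is prime to block [i]. Minimality puts
    [Y] inside the normal complement to any other block, so only primes of block [i] divide its
    order. Choosing a minimal [Y] avoids an intersection over the possibly infinite type [I]. *)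
Lemma sigma_nilpotent_Hall_normal i G : sigma_nilpotent sigma G ->
  exists2 Y : {group gT}, Y <| G & (sigma i).-Hall(G) Y.
Proof.
move/sigma_nilpotent_blocks=> nilG.
pose Q Y := (Y <| G) && (sigma i)^'.-nat #|G : Y|.
have [Y /mingroupP[/andP[nsYG i'GY] minY]] : {Y | [min Y | Q Y]}.
  by apply: ex_mingroup; exists G; rewrite /Q normal_refl indexgg.
exists Y => //; rewrite /pHall (normal_sub nsYG) i'GY andbT.
apply/pgroupP=> p p_pr pY; apply/idPn=> pi'.
have [_ cover _] := sigmaP; have [j pj] := cover p p_pr.
have [X [nsXG j'X jGX]] := (block_nilpotentP j G).1 (nilG j).
have defY : (Y :&: X)%G :=: Y.
  apply: minY; last exact: subsetIl.
  rewrite /Q normalI // -(Lagrange_index (normal_sub nsYG)) ?subsetIl // pnatM.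
  rewrite i'GY indexgI; apply: sub_in_pnat (pnat_index_sub nsXG _ jGX).
    by move=> q _; apply: sub_block_compl (sigma_block_neq pj pi') q.
  exact: normal_sub.
have sYX : Y \subset X by rewrite -defY subsetIr.
by have /pgroupP/(_ p p_pr pY) := pgroupS sYX j'X; rewrite inE /= pj.
Qed.

End OneGroupType.

(** * Sigma-soluble groups and normalisers of Hall subgroups *)

Lemma sigma_soluble_quotient (gT : finGroupType) (G N : {group gT}) :
  N <| G -> sigma_soluble sigma G -> sigma_soluble sigma (G / N).
Proof.
move=> nsNG solG K H chHK.
have [i iHK] := solG _ _ (chief_factor_cosetpre nsNG chHK); exists i; move: iHK.
have /andP[/maxgroupp/andP[ltKH nKG] nsHG] := chHK.
have nKH : H \subset 'N(K) := subset_trans (normal_sub nsHG) nKG.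
rewrite /pgroup !card_quotient ?index_cosetpre //.
exact: subset_trans (morphpreS _ nKH) (morphpre_norm _ _).
Qed.

Lemma sigma_soluble_Hall_nilpotent (gT : finGroupType) (G : {group gT}) :
    sigma_soluble sigma G ->
    (forall i (H : {group gT}),
       (sigma i).-Hall(G) H -> 'N_G(H) \subset H * 'C_G(H)) ->
  sigma_nilpotent sigma G.
Proof.
(* The ambient type is generalised along with [G], since [G / N] lives in another type. *)
have [n] := ubnP #|G|; elim: n => // n IHn in gT G *; rewrite ltnS => leGn.
move=> solG hypG; apply/sigma_nilpotent_blocks => j; apply/block_nilpotentP.
have [G1 | ntG] := eqsVneq G 1.
  by exists G; rewrite normal_refl indexgg G1 pgroup1.
have [N minN sNG] := minnormal_exists ntG (normG G).
have [i] := solG _ _ (minnormal_chief_factor minN sNG).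
rewrite /pgroup card_quotient ?norms1 // indexg1 => piN.
have [/andP[ntN nNG] _] := mingroupP minN.
have nsNG : N <| G by apply/andP.
have nilGN : sigma_nilpotent sigma (G / N).
  apply: IHn; first exact: leq_trans (ltn_quotient ntN sNG) leGn.
    exact: sigma_soluble_quotient.
  (* By disjointness of the blocks, the [sigma i]-group [N] is a [sigma k]-group or a
     [(sigma k)^']-group for each [k]. *)
  move=> k; apply: Hall_norm_cent_quotient (hypG k) => //; apply/orP.
  have [<- | ik] := pselect (i = k); [by left | right].
  exact: sub_pgroup (sub_block_compl ik) piN.
have [<- | ij] := pselect (i = j); last first.
  have /sigma_nilpotent_blocks/(_ j)/block_nilpotentP[X [nsX j'X jX]] := nilGN.
  exists (coset N @*^-1 X)%G; split.
  - by rewrite -(quotientGK nsNG) cosetpre_normal.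
  - rewrite /pgroup card_cosetpre pnatM; apply/andP; split=> //.
    exact: sub_pgroup (sub_block_compl ij) piN.
  - by rewrite -(quotientGK nsNG) index_cosetpre.
have [Y nsYG hallY] := sigma_nilpotent_Hall_normal i nilGN.
have [P defY sNP nsPG] := inv_quotientN nsNG nsYG.
have nsNP : N <| P := normalS sNP (normal_sub nsPG) nsNG.
have hallP : (sigma i).-Hall(G) P.
  by rewrite -(pquotient_pHall piN nsNG nsNP) -defY.
apply: normal_Hall_cent_compl (hallP) _ => //.
by have := hypG i P hallP; rewrite (setIidPl (normal_norm nsPG)).
Qed.

(** The normaliser of [H] inherits nilpotency, so it has a normal complement [X] to block [i]. Both
    [H] and [X] are normal there and meet trivially, so they commute. *)
Lemma sigma_nilpotent_norm_cent (gT : finGroupType) i (G H : {group gT}) :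
  sigma_nilpotent sigma G -> (sigma i).-Hall(G) H ->
  'N_G(H) \subset H * 'C_G(H).
Proof.
move=> nilG hallH; have [sHG iH i'H] := and3P hallH.
have sNG : 'N_G(H) \subset G := subsetIl _ _.
have /sigma_nilpotent_blocks/(_ i)/block_nilpotentP := sigma_nilpotentS sNG nilG.
move=> [X [nsXN i'X iX]].
have sHN : H \subset 'N_G(H) by rewrite subsetI sHG normG.
have tiHX : H :&: X = 1 := coprime_TIg (pnat_coprime iH i'X).
have sXN := normal_sub nsXN.
have cHX : X \subset 'C(H).
  rewrite (sameP commG1P trivgP) -tiHX setIC commg_subI //.
    by rewrite subsetI subxx (subset_trans sXN) ?subsetIr.
  by rewrite subsetI subxx (subset_trans sHN) ?normal_norm.
have sXC : X \subset 'C_G(H) by rewrite subsetI (subset_trans sXN).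
have i'NH : (sigma i)^'.-nat #|'N_G(H) : H|.
  by rewrite (pnat_dvd _ i'H) // indexSg.
(* The indices of [H] and [X] in the normaliser are coprime, so [H * X] is the whole normaliser. *)
rewrite -(coprime_index_mulG sHN sXN) ?mulgS //.
by rewrite coprime_sym (pnat_coprime iX i'NH).
Qed.

Lemma exists_sigma_nilpotent_critical (gT : finGroupType) (G : {group gT}) :
  ~ sigma_nilpotent sigma G ->
  exists2 H : {group gT}, H \subset G & sigma_nilpotent_critical sigma H.
Proof.
move=> not_nilG; pose Q (H : {group gT}) := ~~ `[< sigma_nilpotent sigma H >].
have [|H minH sHG] := @mingroup_exists _ Q G; first exact/asboolPn.
have [/asboolPn not_nilH minHQ] := mingroupP minH.
exists H => //; split=> // K ltKH; apply: contrapT => not_nilK.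
have := ltKH; rewrite (minHQ K) ?properxx ?proper_sub //.
exact/asboolPn.
Qed.

End SigmaNilpotency.

(** * The cycle of implications between the four conditions *)

Theorem theorem1p12 (I : Type) (sigma : I -> nat_pred)
    (sigmaP : prime_partition sigma) (gT : finGroupType) (G : {group gT})
    (ntG : G :!=: 1) :
  [<-> sigma_nilpotent sigma G;
       all_isolated (Hawkes_graph sigma G);
       all_isolated (Vasilev_Murashko_graph sigma G);
       sigma_soluble sigma G /\ all_isolated (Hall_graph sigma G)].
Proof.
(* Isolation quantifies over vertices only, so both ends of a candidate edge must be shown to lie in
   [sigma_of sigma #|G|]. *)
have sigma_dvd m i :
    (m %| #|G|)%N -> sigma_of sigma m i -> sigma_of sigma #|G| i.
  exact: sigma_of_dvd.
tfae=> [nilG | isoG | isoG | [solG isoG]].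
- move=> i _ j _ /=.
  have F1 k : #|G / block_Fitting sigma k G| = 1%N.
    apply/(block_Fitting_id sigmaP).
    by move/(sigma_nilpotent_blocks sigmaP): nilG; apply.
  by split; rewrite F1 => -[p].
(* Nilpotency of [G] is recovered first; it passes to all subgroups, so [G] has no critical subgroup
   and its Vasil'ev-Murashko graph has no edge. *)
- have nilG : sigma_nilpotent sigma G.
    apply/(sigma_nilpotent_blocks sigmaP) => i.
    have [Gi | ] := pselect (sigma_of sigma #|G| i); last first.
      exact: block_nilpotent_sigma'.
    apply/(block_Fitting_id sigmaP); apply: contrapT => /eqP ntGF.
    have [j GFj] := sigma_of_neq1 sigmaP (cardG_gt0 _) ntGF.
    by have [] := isoG i Gi j (sigma_dvd _ _ (dvdn_quotient _ _) GFj).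
  by move=> i _ j _; split=> -[H [sHG [[] //]]]; apply: sigma_nilpotentS nilG.
(* A critical subgroup [H] without edges would equal its Fitting subgroup for every block dividing
   its order, hence be nilpotent. *)
- have nilG : sigma_nilpotent sigma G.
    apply: contrapT => /(exists_sigma_nilpotent_critical)[H sHG critH].
    have [not_nilH _] := critH; apply: not_nilH.
    apply/(sigma_nilpotent_blocks sigmaP) => i.
    have [Hi | ] := pselect (sigma_of sigma #|H| i); last first.
      exact: block_nilpotent_sigma'.
    apply/(block_Fitting_id sigmaP); apply: contrapT => /eqP ntHF.
    have [j HFj] := sigma_of_neq1 sigmaP (cardG_gt0 _) ntHF.
    have dvdHG := cardSg sHG.
    have dvdHF := dvdn_trans (dvdn_quotient _ _) dvdHG.
    have [] := isoG i (sigma_dvd _ _ dvdHG Hi) j (sigma_dvd _ _ (dvdHF _) HFj).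
    by case; exists H.
  split=> [K H /nilG[i [iHK _]] | ]; first by exists i.
  have noedge i j : ~ edge (Hall_graph sigma G) i j.
    case=> H /(sigma_nilpotent_norm_cent sigmaP nilG) /norm_cent_quotient1 ->.
    by case=> p.
  by move=> i _ j _; split; apply: noedge.
apply: sigma_soluble_Hall_nilpotent => // i H hallH.
have [Gi | not_Gi] := pselect (sigma_of sigma #|G| i).
  apply/norm_cent_quotient1; apply: contrapT => /eqP ntN.
  have dvdNG := norm_cent_quotient_dvd G H.
  have [|j Nj] := sigma_of_neq1 sigmaP _ ntN.
    by rewrite (dvdn_gt0 _ dvdNG).
  by have [[]] := isoG i Gi j (sigma_dvd _ _ dvdNG Nj); exists H.
(* Isolation says nothing about a block outside [sigma_of sigma #|G|], but its Hall subgroup is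
   trivial. *)
have -> : H :=: 1.
  apply: contrapT => /eqP ntH; apply: not_Gi; have [sHG iH _] := and3P hallH.
  have pH := pi_pdiv #|H|; rewrite cardG_gt1 ntH in pH.
  by exists (pdiv #|H|); [exact: piSg pH | exact: pnatPpi pH].
by rewrite cent1T mul1g setIT subsetIl.
Qed.
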